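(* Each extension $\mathsf{L}$ of $\mathsf{FL}^k_{ew}$ is axiomatisable by $(\cdot,\vee,1)$-canonical formulas. Furthermore, if $\mathsf{L}$ is finitely axiomatisable, then $\mathsf{L}$ is axiomatisable by finitely many $(\cdot,\vee,1)$-canonical formulas.
   Context: Here $k$ is a natural number. A commutative residuated lattice is an algebra $\langle A,\cdot,\to,\wedge,\vee,1\rangle$ where $\langle A,\cdot,1\rangle$ is a commutative monoid, $\langle A,\wedge,\vee\rangle$ is a lattice (with order $\le$), and $x\cdot y\le z$ iff $y\le x\to z$. It is bounded if its order has a largest element $\top$ and a least element $\bot$, integral if it is bounded and $\top=1$ (so $x\le 1$ for all $x$), and $k$-potent if $x^{k}=x^{k+1}$ for all $x$. It is pointed if the type is expanded by an additional constant $0$, which may be evaluated arbitrarily. $k\text{-}\mathsf{CIRL}$ denotes the class of $k$-potent, commutative, integral residuated lattices; the constant $0$ may or may not be included in the type (the result is meant for either choice, made in the same way for the algebras and for the formulas). Write $a\leftrightarrow b$ for $(a\to b)\wedge(b\to a)$. An algebra $A$ is subdirectly irreducible if, whenever it embeds into a direct product of algebras in such a way that the compositions of the embedding with the projections are surjective, $A$ is isomorphic to one of the algebras in the product. Formulas are identified with terms in the language of these algebras. For $B\in k\text{-}\mathsf{CIRL}$, $B\models\varphi$ means that $v(\varphi)=1$ for every valuation $v$ into $B$ (homomorphism from the algebra of terms to $B$). $\mathsf{FL}^k_{ew}$ is the Full Lambek calculus with exchange, weakening and the $k$-potency axiom $\varphi^{k}\leftrightarrow\varphi^{k+1}$; $k\text{-}\mathsf{CIRL}$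 is its equivalent algebraic semantics. An extension $\mathsf{L}$ of $\mathsf{FL}^k_{ew}$ is an axiomatic extension, i.e. a logic obtained by adding a set of formulas to $\mathsf{FL}^k_{ew}$ as new axioms; $\mathsf{L}$ is axiomatised by a set $\Sigma$ of formulas if it is obtained by adding $\Sigma$ to $\mathsf{FL}^k_{ew}$ as axioms, equivalently if the class $\mathbb{V}_{\mathsf L}$ of algebras corresponding to $\mathsf{L}$ is $\{B\in k\text{-}\mathsf{CIRL}\mid B\models\sigma\text{ for all }\sigma\in\Sigma\}$. It is finitely axiomatisable if it is axiomatised by some finite $\Sigma$. Canonical formulas: let $A\in k\text{-}\mathsf{CIRL}$ be finite and subdirectly irreducible, and let $D^{\wedge},D^{\to}$ be subsets of $A^2$. For each $a\in A$ introduce a new variable $X_a$. Let $\Gamma$ be the meet of the formulas: $X_{\bot}\leftrightarrow\bot$ (where $X_\bot$ is the variable of the least element of $A$ and $\bot$ stands for the least element of the algebra in which the formula is evaluated); $X_{1}\leftrightarrow 1$; $X_{a\cdot b}\leftrightarrow (X_a\cdot X_b)$ and $X_{a\vee b}\leftrightarrow (X_a\vee X_b)$ for all $a,b\in A$; $X_{a\to b}\leftrightarrow (X_a\to X_b)$ for $(a,b)\in D^{\to}$; and $X_{a\wedge b}\leftrightarrow (X_a\wedge X_b)$ for $(a,b)\in D^{\wedge}$. Let $\Delta:=\bigvee\{X_a\to X_b\mid a,b\in A,\ a\not\le b\}$. The $(\cdot,\vee,1)$-canonical formula associated with $A,D^\wedge,D^\to$ is $\gamma(A,D^{\wedge},D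^{\to}):=\Gamma^{k}\to\Delta$.
   Formalization: When the constant 0 is in the type, Γ has the extra conjunct X_0 ↔ 0 (X_0 the variable of the value of 0 in A); without it the claim fails, e.g. for the extension by the axiom 0. The least element ⊥ is taken as a constant of the formula language. *)

(* Defs.v *)
From mathcomp Require Import all_boot.
From mathcomp Require Import boolp classical_sets cardinality.

Set Implicit Arguments.
Unset Strict Implicit.
Unset Printing Implicit Defensive.

Local Open Scope classical_set_scope.

(* Throughout, p : bool tells whether the constant 0 belongs to the type. The
   constant is a function of a proof of p, hence vacuous when p = false. *)

Record crl (p : bool) (T : Type) := CRL {
  mul : T -> T -> T;
  imp : T -> T -> T;
  meet : T -> T -> T;
  join : T -> T -> T;
  one : T;
  zero : p -> T;
  mulA : associative mul;
  mulC : commutative mul;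
  mul1 : left_id one mul;
  meetA : associative meet;
  meetC : commutative meet;
  joinA : associative join;
  joinC : commutative join;
  joinK : forall x y, meet x (join x y) = x;
  meetK : forall x y, join x (meet x y) = x;
  residuation : forall x y z,
    meet (mul x y) z = mul x y <-> meet y (imp x z) = y
}.

Definition le p T (A : crl p T) (x y : T) : Prop := meet A x y = x.

Definition pow p T (A : crl p T) (x : T) (n : nat) : T :=
  iter n (mul A x) (one A).

(* The least element is not part of the type: [bot] only witnesses that the
   order is bounded below, and homomorphisms are those of [crl]. *)
Record kcirl (k : nat) (p : bool) (T : Type) := KCIRL {
  kcirl_crl :> crl p T;
  bot : T;
  bot_le : forall x, le kcirl_crl bot x;
  le_one : forall x, le kcirl_crl x (one kcirl_crl);
  kpotent : forall x, pow kcirl_crl x k = pow kcirl_crl x k.+1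
}.

Record is_hom p T U (A : crl p T) (B : crl p U) (f : T -> U) : Prop := IsHom {
  hom_mul : {morph f : x y / mul A x y >-> mul B x y};
  hom_imp : {morph f : x y / imp A x y >-> imp B x y};
  hom_meet : {morph f : x y / meet A x y >-> meet B x y};
  hom_join : {morph f : x y / join A x y >-> join B x y};
  hom_one : f (one A) = one B;
  hom_zero : forall h : p, f (zero A h) = zero B h
}.

Definition isomorphic p T U (A : crl p T) (B : crl p U) : Prop :=
  exists2 f : T -> U, is_hom A B f & bijective f.

Program Definition crl_prod p (I : Type) (T : I -> Type)
    (A : forall i, crl p (T i)) : crl p (forall i, T i) :=
  {| mul := fun x y i => mul (A i) (x i) (y i);
     imp := fun x y i => imp (A i) (x i) (y i);
     meet := fun x y i => meet (A i) (x i) (y i);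
     join := fun x y i => join (A i) (x i) (y i);
     one := fun i => one (A i);
     zero := fun h i => zero (A i) h |}.
Next Obligation. by move=> *; apply: functional_extensionality_dep => i; rewrite mulA. Qed.
Next Obligation. by move=> *; apply: functional_extensionality_dep => i; rewrite mulC. Qed.
Next Obligation. by move=> *; apply: functional_extensionality_dep => i; rewrite mul1. Qed.
Next Obligation. by move=> *; apply: functional_extensionality_dep => i; rewrite meetA. Qed.
Next Obligation. by move=> *; apply: functional_extensionality_dep => i; rewrite meetC. Qed.
Next Obligation. by move=> *; apply: functional_extensionality_dep => i; rewrite joinA. Qed.
Next Obligation. by move=> *; apply: functional_extensionality_dep => i; rewrite joinC. Qed.
Next Obligation. by apply: functional_extensionality_dep => i; rewrite joinK. Qed.
Next Obligation. by apply: functional_extensionality_dep => i; rewrite meetK. Qed.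
Next Obligation.
split=> H; apply: functional_extensionality_dep => i;
  apply/(residuation (A i)); exact: (f_equal (fun g => g i) H).
Qed.

(* The family may be empty, so the one-element algebra is excluded. *)
Definition subdirectly_irreducible p T (A : crl p T) : Prop :=
  forall (I : Type) (U : I -> Type) (B : forall i, crl p (U i))
         (f : T -> forall i, U i),
    is_hom A (crl_prod B) f -> injective f ->
    (forall i (y : U i), exists x, f x i = y) ->
  exists i, isomorphic A (B i).

Inductive formula (p : bool) : Type :=
| Var of nat
| One
| Bot
| Zero of p
| Mul of formula p & formula p
| Imp of formula p & formula p
| Meet of formula p & formula p
| Join of formula p & formula p.

Arguments Var {p} _.
Arguments One {p}.
Arguments Bot {p}.
Arguments Zero {p} _.

Definition Iff p (a b : formula p) : formula p := Meet (Imp a b) (Imp b a).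

Definition Pow p (a : formula p) (n : nat) : formula p := iter n (Mul a) One.

Definition BigMeet p (s : seq (formula p)) : formula p :=
  \big[@Meet p/One]_(a <- s) a.

Definition BigJoin p (s : seq (formula p)) : formula p :=
  \big[@Join p/Bot]_(a <- s) a.

Fixpoint subst p (s : nat -> formula p) (a : formula p) : formula p :=
  match a with
  | Var n => s n
  | One => One
  | Bot => Bot
  | Zero h => Zero h
  | Mul a b => Mul (subst s a) (subst s b)
  | Imp a b => Imp (subst s a) (subst s b)
  | Meet a b => Meet (subst s a) (subst s b)
  | Join a b => Join (subst s a) (subst s b)
  end.

(* Sequent calculus for FL with exchange and weakening, with k-potency and all
   substitution instances of Sigma as initial sequents. There is no rule for
   Zero since 0 may be evaluated arbitrarily; Bot is the least element. *)
Inductive derives k p (Sigma : set (formula p)) :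
    seq (formula p) -> formula p -> Prop :=
| d_id a : derives k Sigma [:: a] a
| d_cut G D a c : derives k Sigma G a -> derives k Sigma (a :: D) c ->
    derives k Sigma (G ++ D) c
| d_exchange G D a b c : derives k Sigma (G ++ a :: b :: D) c ->
    derives k Sigma (G ++ b :: a :: D) c
| d_weakening G a c : derives k Sigma G c -> derives k Sigma (a :: G) c
| d_oneL G c : derives k Sigma G c -> derives k Sigma (One :: G) c
| d_oneR : derives k Sigma [::] One
| d_botL G c : derives k Sigma (Bot :: G) c
| d_mulL G a b c : derives k Sigma (a :: b :: G) c ->
    derives k Sigma (Mul a b :: G) c
| d_mulR G D a b : derives k Sigma G a -> derives k Sigma D b ->
    derives k Sigma (G ++ D) (Mul a b)
| d_impL G D a b c : derives k Sigma G a -> derives k Sigma (b :: D) c ->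
    derives k Sigma (Imp a b :: G ++ D) c
| d_impR G a b : derives k Sigma (a :: G) b -> derives k Sigma G (Imp a b)
| d_meetL1 G a b c : derives k Sigma (a :: G) c ->
    derives k Sigma (Meet a b :: G) c
| d_meetL2 G a b c : derives k Sigma (b :: G) c ->
    derives k Sigma (Meet a b :: G) c
| d_meetR G a b : derives k Sigma G a -> derives k Sigma G b ->
    derives k Sigma G (Meet a b)
| d_joinL G a b c : derives k Sigma (a :: G) c -> derives k Sigma (b :: G) c ->
    derives k Sigma (Join a b :: G) c
| d_joinR1 G a b : derives k Sigma G a -> derives k Sigma G (Join a b)
| d_joinR2 G a b : derives k Sigma G b -> derives k Sigma G (Join a b)
| d_potency a : derives k Sigma [::] (Iff (Pow a k) (Pow a k.+1))
| d_axiom s a : Sigma a -> derives k Sigma [::] (subst s a).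

Definition logic k p (Sigma : set (formula p)) : set (formula p) :=
  [set a | derives k Sigma [::] a].

Definition axiomatised_by k p (L Sigma : set (formula p)) : Prop :=
  L = logic k Sigma.

Definition is_extension k p (L : set (formula p)) : Prop :=
  exists Sigma, axiomatised_by k L Sigma.

Definition finitely_axiomatisable k p (L : set (formula p)) : Prop :=
  exists2 Sigma, finite_set Sigma & axiomatised_by k L Sigma.

Section CanonicalFormula.
Variables (k : nat) (p : bool) (T : finType) (A : kcirl k p T).
Variables Dmeet Dimp : {set T * T}.

Definition X (a : T) : formula p := Var (enum_rank a).

Definition clauses (op : T -> T -> T)
    (con : formula p -> formula p -> formula p) (D : {set T * T}) :=
  [seq Iff (X (op ab.1 ab.2)) (con (X ab.1) (X ab.2)) | ab in D].

(* When 0 is in the type it must be described like the constants 1 and Bot: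
   otherwise no canonical formula would mention Zero, and the extension
   axiomatised by Zero itself would have no canonical axiomatisation. *)
Definition zero_clause : seq (formula p) :=
  match p as q return (q -> T) -> seq (formula q) with
  | true => fun z => [:: Iff (Var (enum_rank (z isT))) (Zero isT)]
  | false => fun _ => [::]
  end (zero A).

Definition Gamma : formula p :=
  BigMeet ([:: Iff (X (bot A)) Bot; Iff (X (one A)) One] ++ zero_clause
    ++ clauses (mul A) (@Mul p) [set: T * T]
    ++ clauses (join A) (@Join p) [set: T * T]
    ++ clauses (imp A) (@Imp p) Dimp
    ++ clauses (meet A) (@Meet p) Dmeet).

Definition Delta : formula p :=
  BigJoin [seq Imp (X ab.1) (X ab.2)
          | ab in [pred ab : T * T | meet A ab.1 ab.2 != ab.1]].

Definition gamma : formula p := Imp (Pow Gamma k) Delta.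

End CanonicalFormula.

Definition canonical_formulas (k : nat) (p : bool) : set (formula p) :=
  [set a | exists (T : finType) (A : kcirl k p T) (Dmeet Dimp : {set T * T}),
     subdirectly_irreducible A /\ a = gamma A Dmeet Dimp].

Arguments canonical_formulas k p : clear implicits.

(* Main.v *)
(* A logic with a non-theorem [c] has a prime filter [T] (a well-connected
   algebra, on the Lindenbaum side) that contains it and omits [c]. Modulo [T],
   the formulas built by products and joins from the subformulas of [c], [One],
   [Bot] and [Zero] form a finite set because of k-potency, and become an
   algebra [A] once meets and residuals are computed inside that set;
   primeness of [T] makes [1] join-irreducible, so [A] has a coatom and is
   subdirectly irreducible. Let [D] record the pairs on which meet and residual
   agree with those modulo [T]. Substituting representatives for the variables
   [X_a] shows that the canonical formula of [(A, D)] is not in [T].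
   Conversely, [Gamma] forces [a |-> X_a] to be compatible with the
   subformulas of [c], so any logic proving [c] proves the canonical formula.
   Hence a logic is axiomatised by its canonical theorems; the finite case
   follows since derivations are finite. *)
Require Import Defs.
From Stdlib Require Import Setoid Morphisms.
From HB Require Import structures.
From mathcomp Require Import all_boot.
From mathcomp Require Import boolp classical_sets cardinality.

Local Open Scope classical_set_scope.

Set Implicit Arguments.
Unset Strict Implicit.
Unset Printing Implicit Defensive.

(** Membership in lists of formulas rests on this classical equality test. *)
HB.instance Definition _ (p : bool) := gen_eqMixin (formula p).

(** * Substitution, compactness and basic derivations in the sequent calculus *)

Section Sequents.
Variables (k : nat) (p : bool).
Implicit Types (a b c : formula p) (G D : seq (formula p)).
Implicit Types S : set (formula p).

Lemma derives_mono S S' G c :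
  S `<=` S' -> derives k S G c -> derives k S' G c.
Proof.
by move=> sSS'; elim=> {G c}; eauto using derives.
Qed.

Lemma subst_comp (s t : nat -> formula p) a :
  subst s (subst t a) = subst (fun n => subst s (t n)) a.
Proof. by elim: a => //= a -> b ->. Qed.

Lemma subst_id a : subst Var a = a.
Proof. by elim: a => //= a -> b ->. Qed.

Lemma subst_Pow s a n : subst s (Pow a n) = Pow (subst s a) n.
Proof. by rewrite /Pow; elim: n => //= n ->. Qed.

Lemma subst_BigMeet s (r : seq (formula p)) :
  subst s (BigMeet r) = BigMeet [seq subst s a | a <- r].
Proof.
rewrite /BigMeet; elim: r => [|a r IH] /=; rewrite ?big_nil //.
by rewrite !big_cons /= -IH.
Qed.

Lemma subst_BigJoin s (r : seq (formula p)) :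
  subst s (BigJoin r) = BigJoin [seq subst s a | a <- r].
Proof.
rewrite /BigJoin; elim: r => [|a r IH] /=; rewrite ?big_nil //.
by rewrite !big_cons /= -IH.
Qed.

Lemma derives_subst S s G c :
  derives k S G c -> derives k S [seq subst s a | a <- G] (subst s c).
Proof.
elim=> {G c} /=; rewrite /Iff; try by eauto using derives.
- by move=> G D a c _ + _; rewrite map_cat; apply: d_cut.
- by move=> G D a b c _; rewrite !map_cat; apply: d_exchange.
- by move=> G D a b _ + _; rewrite map_cat; apply: d_mulR.
- by move=> G D a b c _ + _; rewrite map_cat; apply: d_impL.
- by move=> a; rewrite !subst_Pow; have := d_potency k S (subst s a).
- by move=> t a Sa; rewrite subst_comp; apply: d_axiom.
Qed.

Lemma derives_axiom S a : S a -> derives k S [::] a.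
Proof. by move=> Sa; rewrite -(subst_id a); apply: d_axiom. Qed.

(** Only the axiom rule needs work: an instance of a formula of [S] is derived by substituting
    throughout its derivation from [S']. *)
Lemma derives_trans S S' G c :
  S `<=` logic k S' -> derives k S G c -> derives k S' G c.
Proof.
move=> sSS'; elim=> {G c}; try by eauto using derives.
by move=> s a /sSS'; exact: (@derives_subst S' s [::]).
Qed.

(** A derivation is a finite tree, so the finite sets of axioms used by the premises of a rule can
    be merged at every node. *)
Lemma derives_compact S G c : derives k S G c ->
  exists S0, [/\ finite_set S0, S0 `<=` S & derives k S0 G c].
Proof.
(* [join2], [join1] and [join0] serve the rules with two, one and no premises. Each rule is required
   over every axiom set, so that it still applies to the merged one. *)
have join2 (G1 G2 G3 : seq (formula p)) c1 c2 c3 :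
    (forall S0, derives k S0 G1 c1 -> derives k S0 G2 c2 ->
                derives k S0 G3 c3) ->
    (exists S0, [/\ finite_set S0, S0 `<=` S & derives k S0 G1 c1]) ->
    (exists S0, [/\ finite_set S0, S0 `<=` S & derives k S0 G2 c2]) ->
    exists S0, [/\ finite_set S0, S0 `<=` S & derives k S0 G3 c3].
  move=> rule [S1 [f1 s1 d1]] [S2 [f2 s2 d2]]; exists (S1 `|` S2); split.
  - by rewrite finite_setU.
  - by rewrite subUset.
  - apply: rule; [apply: derives_mono d1|apply: derives_mono d2];
      [exact: subsetUl|exact: subsetUr].
have join1 (G1 G3 : seq (formula p)) c1 c3 :
    (forall S0, derives k S0 G1 c1 -> derives k S0 G3 c3) ->
    (exists S0, [/\ finite_set S0, S0 `<=` S & derives k S0 G1 c1]) ->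
    exists S0, [/\ finite_set S0, S0 `<=` S & derives k S0 G3 c3].
  by move=> rule [S0 [? ? ?]]; exists S0; split=> //; apply: rule.
have join0 (G3 : seq (formula p)) c3 : (forall S0, derives k S0 G3 c3) ->
    exists S0, [/\ finite_set S0, S0 `<=` S & derives k S0 G3 c3].
  by exists set0; split; [exact: finite_set0|exact: sub0set|].
elim=> {G c};
  try (by [move=> *; apply: join0; eauto using derives
         | move=> *; apply: join1; eauto using derives
         | move=> *; apply: join2; eauto using derives]).
move=> s a Sa; exists [set a].
by split; [exact: finite_set1|move=> _ ->|exact: d_axiom].
Qed.

Section Derivations.
Variable S : set (formula p).
Local Notation "G |- a" := (derives k S G a) (at level 75).

Lemma exchange2 a b G c : b :: a :: G |- c -> a :: b :: G |- c.
Proof. exact: (@d_exchange k p S [::]). Qed.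

Lemma exchange3 a b c G x : c :: a :: b :: G |- x -> a :: b :: c :: G |- x.
Proof.
move=> H; apply: (@d_exchange k p S [:: a]) => /=; exact: exchange2.
Qed.

Lemma derives_head a G : a :: G |- a.
Proof.
elim: G => [|b G IH]; first exact: d_id.
by apply: exchange2; apply: d_weakening.
Qed.

Lemma derives_mp a b G c : b :: G |- c -> Imp a b :: a :: G |- c.
Proof. by apply: (@d_impL k p S [:: a]); apply: d_id. Qed.

Lemma derives_impE G a b : G |- Imp a b -> a :: G |- b.
Proof.
(* Cutting with modus ponens leaves [a] at the right end of the antecedent; repeated exchange
   carries it to the front. *)
move=> H; suff: G ++ [:: a] |- b.
  elim/last_ind: G {H} => [//|G x IH].
  have perm1 D E : D ++ rcons E a |- b -> D ++ a :: E |- b.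
    elim: E D => [//|y E IHE] D; rewrite rcons_cons -cat_rcons => /IHE.
    by rewrite cat_rcons; apply: d_exchange.
  by rewrite cats1; apply: (perm1 [::]).
apply: d_cut H _; apply: derives_mp; exact: d_id.
Qed.

Lemma derives_trans_imp a b c : [:: Imp a b; Imp b c] |- Imp a c.
Proof.
apply: d_impR; apply: exchange2; apply: derives_mp; apply: exchange2.
by apply: derives_mp; exact: d_id.
Qed.

Lemma derives_curry a b c : [:: Imp (Mul a b) c] |- Imp a (Imp b c).
Proof.
do 2!apply: d_impR; apply: exchange3.
apply: (@d_impL k p S [:: b; a] [::]); last exact: d_id.
apply: exchange2; apply: (@d_mulR k p S [:: a]); exact: d_id.
Qed.

Lemma derives_uncurry a b c : [:: Imp a (Imp b c)] |- Imp (Mul a b) c.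
Proof.
apply: d_impR; apply: d_mulL; apply: exchange3.
by do 2!apply: derives_mp; exact: d_id.
Qed.

Lemma derives_mulC a b : [:: Mul a b] |- Mul b a.
Proof.
by apply: d_mulL; apply: exchange2; apply: (@d_mulR k p S [:: b]);
  exact: d_id.
Qed.

Lemma derives_mulA a b c : [:: Mul a (Mul b c)] |- Mul (Mul a b) c.
Proof.
apply: d_mulL; apply: exchange2; apply: d_mulL; apply: exchange3.
apply: (@d_mulR k p S [:: a; b] [:: c]); last exact: d_id.
by apply: (@d_mulR k p S [:: a]); exact: d_id.
Qed.

Lemma derives_meet c a b : [:: Imp c a; Imp c b] |- Imp c (Meet a b).
Proof.
apply: d_impR; apply: d_meetR; apply: exchange2.
  by apply: derives_mp; exact: derives_head.
by apply: d_weakening; apply: exchange2; apply: derives_mp; exact: d_id.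
Qed.

Lemma derives_join c a b : [:: Imp a c; Imp b c] |- Imp (Join a b) c.
Proof.
apply: d_impR; apply: d_joinL; apply: exchange2.
  by apply: derives_mp; exact: derives_head.
by apply: d_weakening; apply: exchange2; apply: derives_mp; exact: d_id.
Qed.

End Derivations.
End Sequents.

(** * Deductive filters and the Lindenbaum algebra modulo a filter *)

(** Only theorems of the base logic are imposed and closure under substitution is not, so a filter
    can be generated by a single formula and enlarged to a prime one. *)
Definition dfilter k p (T : set (formula p)) : Prop :=
  (forall a, derives k set0 [::] a -> T a) /\
  (forall a b, T (Imp a b) -> T a -> T b).

Section FilterTheory.
Variables (k : nat) (p : bool) (T : set (formula p)).
Hypothesis FT : dfilter k T.
Implicit Types a b c : formula p.

(** The order of the Lindenbaum algebra modulo [T]; [coentails] is its congruence. Formulas are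
    handled up to this congruence and no quotient is formed. *)
Definition entails a b := T (Imp a b).
Definition coentails a b := entails a b /\ entails b a.
Local Notation "a <~ b" := (entails a b) (at level 70).
Local Notation "a =~ b" := (coentails a b) (at level 70).

(** The antecedent is moved to the right as nested implications, which modus ponens inside [T] then
    discharges. Every derived sequent thus becomes a closure rule of [T]. *)
Lemma filter_derives G c :
  derives k set0 G c -> (forall a, a \in G -> T a) -> T c.
Proof.
elim: G c => [|x G IH] c H TG; first exact: FT.1.
apply: (FT.2 x); last by apply: TG; rewrite mem_head.
by apply: IH (d_impR H) _ => a aG; apply: TG; rewrite in_cons aG orbT.
Qed.

Lemma filter1 a b : derives k set0 [:: a] b -> T a -> T b.
Proof.
move=> H Ta; apply: filter_derives H _ => x.
by rewrite mem_seq1 => /eqP->.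
Qed.

Lemma filter2 a b c : derives k set0 [:: a; b] c -> T a -> T b -> T c.
Proof.
move=> H Ta Tb; apply: filter_derives H _ => x.
by rewrite in_cons mem_seq1 => /orP[] /eqP->.
Qed.

Lemma derives_entails a b : derives k set0 [:: a] b -> a <~ b.
Proof. by move=> H; apply: FT.1; exact: d_impR. Qed.

Lemma entails_refl a : a <~ a.
Proof. by apply: derives_entails; exact: d_id. Qed.

Lemma entails_trans b a c : a <~ b -> b <~ c -> a <~ c.
Proof. by apply: filter2; exact: derives_trans_imp. Qed.

Lemma coentails_refl a : a =~ a.
Proof. by split; exact: entails_refl. Qed.

Lemma coentails_sym a b : a =~ b -> b =~ a.
Proof. by case. Qed.

Lemma coentails_trans b a c : a =~ b -> b =~ c -> a =~ c.
Proof. by move=> [? ?] [? ?]; split; apply: (@entails_trans b). Qed.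

Lemma entails_mul a b c : Mul a b <~ c <-> a <~ Imp b c.
Proof.
by split; apply: filter1; [exact: derives_curry|exact: derives_uncurry].
Qed.

Lemma mul_comm a b : Mul a b =~ Mul b a.
Proof. by split; apply: derives_entails; exact: derives_mulC. Qed.

Lemma mul_entails a a' b b' : a <~ a' -> b <~ b' -> Mul a b <~ Mul a' b'.
Proof.
have mono x x' y : x <~ x' -> Mul x y <~ Mul x' y.
  move=> xx'; apply/entails_mul; apply: entails_trans xx' _.
  by apply/entails_mul; exact: entails_refl.
move=> /(mono _ _ b) H1 /(mono _ _ a') H2; apply: entails_trans H1 _.
apply: entails_trans (mul_comm _ _).1 _.
by apply: entails_trans H2 _; exact: (mul_comm _ _).1.
Qed.

Lemma mul_assoc a b c : Mul a (Mul b c) =~ Mul (Mul a b) c.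
Proof.
split; first by apply: derives_entails; exact: derives_mulA.
apply: derives_entails; do 2!apply: d_mulL.
apply: (@d_mulR k p _ [:: a] [:: b; c]); first exact: d_id.
by apply: (@d_mulR k p _ [:: b]); exact: d_id.
Qed.

Lemma mul_one a : Mul One a =~ a.
Proof.
split; apply: derives_entails; first by do 2!constructor; exact: d_id.
by apply: (@d_mulR k p _ [::]); [exact: d_oneR|exact: d_id].
Qed.

Lemma entails_one a : a <~ One.
Proof. by apply: derives_entails; apply: d_weakening; exact: d_oneR. Qed.

Lemma bot_entails a : Bot <~ a.
Proof. by apply: derives_entails; exact: d_botL. Qed.

Lemma one_entails a : One <~ a <-> T a.
Proof.
split; last by apply: filter1; apply: d_impR; apply: d_oneL; exact: d_id.
by move=> H; apply: FT.2 H _; apply: FT.1; exact: d_oneR.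
Qed.

Lemma meet_entails1 a b : Meet a b <~ a.
Proof. by apply: derives_entails; apply: d_meetL1; exact: d_id. Qed.

Lemma meet_entails2 a b : Meet a b <~ b.
Proof. by apply: derives_entails; apply: d_meetL2; exact: d_id. Qed.

Lemma entails_meet c a b : c <~ a -> c <~ b -> c <~ Meet a b.
Proof. by apply: filter2; exact: derives_meet. Qed.

Lemma entails_join1 a b : a <~ Join a b.
Proof. by apply: derives_entails; apply: d_joinR1; exact: d_id. Qed.

Lemma entails_join2 a b : b <~ Join a b.
Proof. by apply: derives_entails; apply: d_joinR2; exact: d_id. Qed.

Lemma join_entails c a b : a <~ c -> b <~ c -> Join a b <~ c.
Proof. by apply: filter2; exact: derives_join. Qed.

Lemma mul_entails1 a b : Mul a b <~ a.
Proof.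
apply: entails_trans (mul_entails (entails_refl a) (entails_one b)) _.
by apply: entails_trans (mul_comm _ _).1 (mul_one _).1.
Qed.

Lemma mul_entails2 a b : Mul a b <~ b.
Proof. exact: entails_trans (mul_comm _ _).1 (mul_entails1 _ _). Qed.

Lemma filter_Iff a b : T (Iff a b) <-> a =~ b.
Proof.
split=> [H|[ab ba]].
  split; apply: FT.2 H; [exact: meet_entails1|exact: meet_entails2].
by apply/one_entails; apply: entails_meet; apply/one_entails.
Qed.

Lemma filter_BigMeet (s : seq (formula p)) :
  T (BigMeet s) <-> forall a, a \in s -> T a.
Proof.
rewrite /BigMeet; elim: s => [|x s IH].
  by rewrite big_nil; split=> // _; apply/one_entails; exact: entails_refl.
rewrite big_cons; split=> [H a|H].
  rewrite in_cons => /orP[/eqP->|].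
    by apply: FT.2 H; exact: meet_entails1.
  by move: a; apply/IH; apply: FT.2 H; exact: meet_entails2.
apply/one_entails; apply: entails_meet; apply/one_entails.
  by apply: H; exact: mem_head.
by apply/IH => a H1; apply: H; rewrite in_cons H1 orbT.
Qed.

Lemma filter_BigJoin (s : seq (formula p)) a : a \in s -> T a -> T (BigJoin s).
Proof.
rewrite /BigJoin; elim: s => // x s IH; rewrite in_cons big_cons.
case/orP=> [/eqP<-|/IH H /H]; apply: FT.2;
  [exact: entails_join1|exact: entails_join2].
Qed.

(** Multiplication by [c] has a residual, so it preserves joins. *)
Lemma mul_join a b c : Mul (Join a b) c =~ Join (Mul a c) (Mul b c).
Proof.
split.
  by apply/entails_mul; apply: join_entails; apply/entails_mul;
    [exact: entails_join1|exact: entails_join2].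
by apply: join_entails; apply: mul_entails; rewrite /=;
  auto using entails_join1, entails_join2, entails_refl.
Qed.

Lemma mul_bot a : Mul a Bot =~ Bot.
Proof. by split; [exact: mul_entails2|exact: bot_entails]. Qed.

(** This instance and the next ones make [rewrite] work modulo [T]. *)
#[local] Instance coentails_Equivalence : Equivalence coentails.
Proof.
split; [exact: coentails_refl|exact: coentails_sym|].
by move=> a b c; exact: coentails_trans.
Qed.

#[local] Instance Mul_Proper :
  Proper (coentails ==> coentails ==> coentails) (@Mul p).
Proof.
by move=> a a' [aa' a'a] b b' [bb' b'b]; split; apply: mul_entails.
Qed.

#[local] Instance Join_Proper :
  Proper (coentails ==> coentails ==> coentails) (@Join p).
Proof.
move=> a a' [aa' a'a] b b' [bb' b'b]; split; apply: join_entails;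
  by eauto using entails_trans, entails_join1, entails_join2.
Qed.

#[local] Instance Meet_Proper :
  Proper (coentails ==> coentails ==> coentails) (@Meet p).
Proof.
move=> a a' [aa' a'a] b b' [bb' b'b]; split; apply: entails_meet;
  by eauto using entails_trans, meet_entails1, meet_entails2.
Qed.

#[local] Instance Imp_Proper :
  Proper (coentails ==> coentails ==> coentails) (@Imp p).
Proof.
have mono a a' b b' : a' <~ a -> b <~ b' -> Imp a b <~ Imp a' b'.
  move=> a'a bb'; apply/entails_mul; apply: entails_trans bb'.
  apply: entails_trans (mul_entails (entails_refl _) a'a) _.
  by apply/entails_mul; exact: entails_refl.
by move=> a a' [aa' a'a] b b' [bb' b'b]; split; apply: mono.
Qed.

Lemma filter_coentails a b : a =~ b -> T a <-> T b.
Proof. by case=> ab ba; split; apply: FT.2. Qed.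

Lemma pow_entails a m n : m <= n -> Pow a n <~ Pow a m.
Proof.
move=> /subnK <-; elim: (n - m) => [|j IH]; first exact: entails_refl.
exact: entails_trans (mul_entails2 _ _) IH.
Qed.

(** Up to exponent [k] this is weakening; beyond it, potency supplies one further factor at a
    time. *)
Lemma pow_potent a m : Pow a k <~ Pow a m.
Proof.
have pot : Pow a k <~ Pow a k.+1.
  by apply: FT.2 (meet_entails1 _ _) _; apply: FT.1; exact: d_potency.
case: (leqP m k) => [|/ltnW /subnK <-]; first exact: pow_entails.
elim: (m - k) => [|j IH]; first exact: entails_refl.
apply: entails_trans pot _; exact: mul_entails (entails_refl _) IH.
Qed.

Lemma pow_add a m n : Pow a (m + n) =~ Mul (Pow a m) (Pow a n).
Proof.
elim: m => [|m IH]; first by rewrite add0n /Pow /= mul_one; reflexivity.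
by rewrite addSn /Pow !iterS -/(Pow a _) -mul_assoc -IH; reflexivity.
Qed.

Lemma pow_minn a m : Pow a m =~ Pow a (minn m k).
Proof.
case: (leqP m k) => [_|/ltnW km]; first exact: coentails_refl.
by split; [exact: pow_entails|exact: pow_potent].
Qed.

Lemma mul_ACA a b c d : Mul (Mul a b) (Mul c d) =~ Mul (Mul a c) (Mul b d).
Proof.
rewrite -mul_assoc (mul_assoc b) (mul_comm b) -(mul_assoc c) mul_assoc.
reflexivity.
Qed.

(** * Local finiteness of the product-join fragment *)

Definition represented (s : seq (formula p)) a := exists2 b, b \in s & a =~ b.

Lemma represented_coentails s a b :
  a =~ b -> represented s b -> represented s a.
Proof.
by move=> ab [c cs bc]; exists c => //; exact: coentails_trans ab bc.
Qed.

Lemma mem_represented s a : a \in s -> represented s a.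
Proof. by exists a => //; exact: coentails_refl. Qed.

(** Monomials in [s] with exponents from 0 to [k]. Larger exponents collapse to [k] by [pow_minn],
    so modulo [T] these are all the monomials. *)
Fixpoint products (s : seq (formula p)) : seq (formula p) :=
  if s is g :: s' then
    [seq Mul (Pow g i) m | i <- iota 0 k.+1, m <- products s']
  else [:: One].

Lemma products_cons g s i m : represented (products s) m ->
  represented (products (g :: s)) (Mul (Pow g i) m).
Proof.
case=> m' m's mm'; exists (Mul (Pow g (minn i k)) m').
  by apply: allpairs_f => //; rewrite mem_iota /= add0n ltnS geq_minr.
by rewrite mm' -pow_minn; reflexivity.
Qed.

Lemma products_one s : represented (products s) One.
Proof.
elim: s => [|g s IH]; first exact: mem_represented (mem_head _ _).
apply: represented_coentails (products_cons g 0 IH).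
by rewrite /Pow /= mul_one; reflexivity.
Qed.

Lemma products_gen s g : g \in s -> represented (products s) g.
Proof.
elim: s => // x s IH; rewrite in_cons => /orP[/eqP->|/IH H].
  apply: represented_coentails (products_cons x 1 (products_one s)).
  rewrite /Pow /= (mul_comm _ One) mul_one (mul_comm _ One) mul_one.
  reflexivity.
apply: represented_coentails (products_cons x 0 H).
by rewrite /Pow /= mul_one; reflexivity.
Qed.

(** Regrouping adds the exponents of each generator, and [products_cons] truncates the sum at
    [k]. *)
Lemma products_mul s a b :
  a \in products s -> b \in products s -> represented (products s) (Mul a b).
Proof.
elim: s a b => [|g s IH] a b.
  rewrite !mem_seq1 => /eqP-> /eqP->; exists One; first exact: mem_head.
  exact: mul_one.
move=> /allpairsP[[i m] [_ ms ->]] /allpairsP[[j m'] [_ m's ->]].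
apply: represented_coentails (products_cons g (i + j) (IH _ _ ms m's)).
by rewrite mul_ACA pow_add; reflexivity.
Qed.

(** One join for each sublist of [s], the empty sublist giving [Bot]. *)
Fixpoint joins (s : seq (formula p)) : seq (formula p) :=
  if s is m :: s' then joins s' ++ [seq Join m j | j <- joins s']
  else [:: Bot].

Lemma join_bot a : Join Bot a =~ a.
Proof.
split; last exact: entails_join2.
by apply: join_entails; [exact: bot_entails|exact: entails_refl].
Qed.

Lemma join_comm a b : Join a b =~ Join b a.
Proof.
by split; apply: join_entails; auto using entails_join1, entails_join2.
Qed.

Lemma join_assoc a b c : Join a (Join b c) =~ Join (Join a b) c.
Proof.
by split; repeat apply: join_entails;
  eauto using entails_trans, entails_join1, entails_join2.
Qed.

Lemma join_idem a : Join a a =~ a.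
Proof.
split; last exact: entails_join1.
by apply: join_entails; exact: entails_refl.
Qed.

Lemma joins_bot s : Bot \in joins s.
Proof. by elim: s => [|m s IH] /=; rewrite ?mem_seq1 ?mem_cat ?IH. Qed.

Lemma joins_consl m s a : represented (joins s) a ->
  represented (joins (m :: s)) a.
Proof. by case=> b bs ab; exists b => //=; rewrite mem_cat bs. Qed.

Lemma joins_consr m s a : represented (joins s) a ->
  represented (joins (m :: s)) (Join m a).
Proof.
case=> b bs ab; exists (Join m b).
  by rewrite /= mem_cat map_f // orbT.
by rewrite ab; reflexivity.
Qed.

Lemma joins_mem s a : a \in s -> represented (joins s) a.
Proof.
elim: s => // m s IH; rewrite in_cons => /orP[/eqP->|/IH/joins_consl//].
apply: represented_coentails (joins_consr m (mem_represented (joins_bot s))).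
by rewrite join_comm join_bot; reflexivity.
Qed.

Lemma joins_join s a b : represented (joins s) a -> represented (joins s) b ->
  represented (joins s) (Join a b).
Proof.
move=> [a' + aa'] [b' + bb']; rewrite [Join a b]lock => a's b's.
have {aa' bb'} : locked (Join a b) =~ Join a' b'.
  by rewrite -lock aa' bb'; reflexivity.
move/represented_coentails; apply.
elim: s a' b' a's b's {a b} => [|m s IH] a b /=.
  rewrite !mem_seq1 => /eqP-> /eqP->; exists Bot; first exact: mem_head.
  exact: join_idem.
(* Four cases, according to whether [m] occurs in each of the two joins; when it occurs in both,
   idempotence merges the copies. *)
rewrite !mem_cat => /orP[a_s|/mapP[a' a's ->]] /orP[b_s|/mapP[b' b's ->]].
- by apply: joins_consl; exact: IH.
- apply: represented_coentails (joins_consr m (IH a b' a_s b's)).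
  by rewrite join_assoc (join_comm a) -join_assoc; reflexivity.
- apply: represented_coentails (joins_consr m (IH a' b a's b_s)).
  by rewrite join_assoc; reflexivity.
- apply: represented_coentails (joins_consr m (IH a' b' a's b's)).
  rewrite -join_assoc (join_assoc a') (join_comm a') -join_assoc join_assoc.
  by rewrite join_idem; reflexivity.
Qed.

Lemma joins_ind (P : formula p -> Prop) s : P Bot ->
  (forall a b, a \in s -> P b -> P (Join a b)) ->
  forall a, a \in joins s -> P a.
Proof.
move=> PB; elim: s => [|m s IH] PJ a /=; first by rewrite mem_seq1 => /eqP->.
have {}IH : forall a, a \in joins s -> P a.
  by apply: IH => x y xs; apply: PJ; rewrite in_cons xs orbT.
rewrite mem_cat => /orP[/IH//|/mapP[b /IH Pb ->]].
by apply: PJ Pb; exact: mem_head.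
Qed.

(** Distributivity expands a product of joins of monomials into a join of products of monomials:
    induction on the left factor, then on the right one. *)
Lemma joins_products_mul s a b : represented (joins (products s)) a ->
  represented (joins (products s)) b ->
  represented (joins (products s)) (Mul a b).
Proof.
move=> [a' a's aa'] [b' b's bb'].
apply: (@represented_coentails _ _ (Mul a' b')).
  by rewrite aa' bb'; reflexivity.
move: a' a's {a b aa' bb'}; apply: joins_ind => [|a a' a_s IH].
  apply: represented_coentails (mem_represented (joins_bot _)).
  by rewrite mul_comm mul_bot; reflexivity.
apply: represented_coentails (mul_join _ _ _) _; apply: joins_join IH.
move: b' b's; apply: joins_ind => [|b b' b_s IH].
  apply: represented_coentails (mem_represented (joins_bot _)).
  exact: mul_bot.
apply: (@represented_coentails _ _ (Join (Mul a b) (Mul a b'))).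
  by rewrite mul_comm mul_join !(mul_comm _ a); reflexivity.
apply: joins_join IH.
have [c cs abc] := products_mul a_s b_s.
exact: represented_coentails abc (joins_mem cs).
Qed.

(** Keeping one representative per class makes equality of indices coincide with [coentails], so
    that an algebra can be carried by ['I_n]. *)
Lemma remove_coentails (s : seq (formula p)) : exists n (r : 'I_n -> formula p),
  (forall i j, r i =~ r j -> i = j) /\
  (forall a, (exists i, a =~ r i) <-> represented s a).
Proof.
elim: s => [|x s [n [r [rI rs]]]].
  exists 0, (fun=> Bot); split=> [[]//|a].
  by split=> [[[]]//|[b]]; rewrite in_nil.
have cons a : represented (x :: s) a <-> a =~ x \/ represented s a.
  split=> [[b]|[ax|[b bs ab]]].
  - by rewrite in_cons => /orP[/eqP-> ax|bs ab]; [left|right; exists b].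
  - by exists x => //; exact: mem_head.
  - by exists b => //; rewrite in_cons bs orbT.
have [xs|xs] := pselect (represented s x).
  exists n, r; split=> // a; rewrite rs cons; split; first by right.
  by case=> // ax; exact: represented_coentails ax xs.
(* A class not met before receives index [ord0], and the earlier indices are shifted by [lift]. *)
exists n.+1, (fun i => if unlift ord0 i is Some j then r j else x).
have new j : ~ (r j =~ x).
  by move=> /coentails_sym rx; apply: xs; apply/rs; exists j.
split=> [i j|a].
  case: unliftP => [i' ->|->]; case: unliftP => [j' ->|->] //.
  - by move/rI->.
  - by move/new.
  - by move/coentails_sym/new.
rewrite cons -rs; split=> [[i]|[ax|[j aj]]].
- by case: unliftP => [j _|_]; [right; exists j|left].
- by exists ord0; rewrite unlift_none.
- by exists (lift ord0 j); rewrite liftK.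
Qed.

Lemma finite_fragment (s : seq (formula p)) :
  exists n (r : 'I_n -> formula p),
  [/\ forall i j, r i =~ r j -> i = j,
      forall a, a \in s -> exists i, r i =~ a,
      (exists i, r i =~ One) /\ (exists i, r i =~ Bot),
      forall i j, exists l, r l =~ Mul (r i) (r j) &
      forall i j, exists l, r l =~ Join (r i) (r j)].
Proof.
have [n [r [rI rs]]] := remove_coentails (joins (products s)).
have sym (a : formula p) : represented (joins (products s)) a ->
    exists i, r i =~ a.
  by move=> /rs[i ai]; exists i; exact: coentails_sym.
have rep i : represented (joins (products s)) (r i).
  by apply/rs; exists i; exact: coentails_refl.
have prod a : represented (products s) a ->
    represented (joins (products s)) a.
  by case=> b /joins_mem bs ab; exact: represented_coentails ab bs.
exists n, r; split=> //.
- by move=> a /products_gen/prod/sym.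
- split; apply: sym; first exact: prod (products_one _).
  exact: mem_represented (joins_bot _).
- by move=> i j; apply: sym; exact: joins_products_mul.
- by move=> i j; apply: sym; exact: joins_join.
Qed.

End FilterTheory.

(** * Prime filters *)

(** The filter generated by [M], as Hilbert-style consequence; the hypotheses in [M] are not closed
    under substitution. *)
Inductive ded k p (M : set (formula p)) : formula p -> Prop :=
| ded_thm a : derives k set0 [::] a -> ded k M a
| ded_hyp a : M a -> ded k M a
| ded_mp a b : ded k M (Imp a b) -> ded k M a -> ded k M b.

Definition prime_filter p (T : set (formula p)) : Prop :=
  forall a b, T (Join a b) -> T a \/ T b.

Section Generation.
Variables (k : nat) (p : bool).
Implicit Types (T M F : set (formula p)).

Lemma ded_filter M : dfilter k (ded k M).
Proof. by split; [exact: ded_thm|exact: ded_mp]. Qed.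

Lemma ded_min M T : dfilter k T -> M `<=` T -> ded k M `<=` T.
Proof.
move=> [T0 Tmp] sMT a; elim=> {a}; [exact: T0|exact: sMT|].
by move=> a b _ Tab _; exact: Tmp.
Qed.

Lemma ded_mono M M' : M `<=` M' -> ded k M `<=` ded k M'.
Proof.
move=> sMM'; apply: ded_min; first exact: ded_filter.
by move=> a /sMM'; exact: ded_hyp.
Qed.

Lemma logic_filter (Sigma : set (formula p)) : dfilter k (logic k Sigma).
Proof.
split=> [a|a b ab a1].
  by apply: derives_mono; exact: sub0set.
by have := d_cut a1 (derives_impE ab).
Qed.

(** The exponent counts the uses of [a]: modus ponens adds the exponents of its premises. Potency
    then replaces whatever exponent results by the uniform [k]. *)
Lemma deduction F c a : dfilter k F -> ded k (F `|` [set a]) c ->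
  F (Imp (Pow a k) c).
Proof.
move=> FF H.
suff [m] : exists m, F (Imp (Pow a m) c).
  by apply: (entails_trans FF); exact: (pow_potent FF).
elim: H => {c} [c c0|c [Fc|->]|c d _ [m Hm] _ [j Hj]].
- by exists 0; apply/(one_entails FF); exact: FF.1.
- by exists 0; apply/(one_entails FF).
- by exists 1; exact: (mul_entails1 FF).
exists (m + j); apply: (entails_trans FF) (pow_add FF a m j).1 _.
apply: (entails_trans FF) (mul_entails FF Hm Hj) _.
by apply/(entails_mul FF); exact: (entails_refl FF).
Qed.

(* [x \/ d] distributes over modus ponens since
   [((x -> y) \/ d) * (x \/ d) <= y \/ d]. *)
Lemma join_filter T d : dfilter k T -> dfilter k [set x | T (Join x d)].
Proof.
move=> FT; split=> [a a0|x y /= xy xd].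
  by apply: FT.2 (entails_join1 FT _ _) _; exact: FT.1.
apply: FT.2 xd; apply: FT.2 xy; apply/(entails_mul FT).
have right z : entails T (Mul z d) (Join y d).
  exact: (entails_trans FT (mul_entails2 FT _ _) (entails_join2 FT _ _)).
have left z : entails T (Mul d z) (Join y d).
  exact: (entails_trans FT (mul_entails1 FT _ _) (entails_join2 FT _ _)).
apply: (entails_trans FT) (mul_join FT _ _ _).1 _.
apply: (join_entails FT) => //.
apply: (entails_trans FT) (mul_comm FT _ _).1 _.
apply: (entails_trans FT) (mul_join FT _ _ _).1 _.
apply: (join_entails FT) => //.
apply: (entails_trans FT) (mul_comm FT _ _).1 _.
apply: (entails_trans FT) (entails_join1 FT _ _).
by apply/(entails_mul FT); exact: (entails_refl FT).
Qed.

(** In a chain the larger of two sets serves both premises of a modus ponens. The first alternative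
    covers deductions that use no set of [C], in particular an empty chain. *)
Lemma ded_chain M (C : set (set (formula p))) a :
  total_on C subset -> ded k (M `|` \bigcup_(Y in C) Y) a ->
  ded k M a \/ exists2 Y, C Y & ded k (M `|` Y) a.
Proof.
move=> totC; elim=> {a} [a a0|a [Ma|[Y CY Ya]]|a b _ IHab _ IHa].
- by left; exact: ded_thm.
- by left; exact: ded_hyp.
- by right; exists Y => //; apply: ded_hyp; right.
have up Y : ded k M `<=` ded k (M `|` Y) by apply: ded_mono; exact: subsetUl.
case: IHab IHa => [ab|[Y CY ab]] [a1|[Z CZ a1]].
- by left; exact: ded_mp ab a1.
- by right; exists Z => //; apply: ded_mp a1; exact: up.
- by right; exists Y => //; apply: ded_mp ab _; exact: up.
right; case: (totC _ _ CY CZ) => [YZ|ZY].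
  by exists Z => //; apply: ded_mp a1; apply: ded_mono ab; exact: setUS.
by exists Y => //; apply: ded_mp ab _; apply: ded_mono a1; exact: setUS.
Qed.

Lemma prime_extension M c : ~ ded k M c ->
  exists T, [/\ dfilter k T, M `<=` T, ~ T c & prime_filter T].
Proof.
(* Zorn is applied to sets [N] of additional hypotheses, so that the empty union required for the
   empty chain is admissible. *)
move=> Mc; have [|N [Nc Nmax]] :=
    @Zorn_bigcup _ [set N | ~ ded k (M `|` N) c].
  move=> C CP totC; apply: contrapT => /= /contrapT.
  by case/(ded_chain totC) => [//|[Y CY]]; exact: CP.
set T := ded k (M `|` N) in Nc.
have FT : dfilter k T by exact: ded_filter.
exists T; split=> //; first by move=> a Ma; apply: ded_hyp; left.
(* Maximality of [N], in the form used twice for primeness. *)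
have ext a F : ~ T a -> dfilter k F -> T `<=` F -> F a -> F c.
  move=> Ta FF sTF Fa.
  have /contrapT : ~ ~ ded k (M `|` (N `|` [set a])) c.
    apply: Nmax; split; first exact: subsetUl.
    by move=> sub; apply: Ta; apply: ded_hyp; right; apply: sub; right.
  apply: ded_min => // x [Mx|[Nx|->//]]; apply: sTF; apply: ded_hyp;
    by [left|right].
move=> a b Tab; apply: contrapT => /not_orP[Ta Tb]; apply: Nc.
have sub d : T `<=` [set x | T (Join x d)].
  by move=> x; apply: FT.2; exact: (entails_join1 FT).
(* If neither [a] nor [b] is in [T], maximality replaces [a] by [c] in [Join a b], and then [b] by
   [c]; the resulting [Join c c] puts [c] in [T]. *)
have Tcb : T (Join c b) by exact: ext (join_filter b FT) (sub b) Tab.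
apply/(filter_coentails FT (join_idem FT c)).
apply: (ext b _ Tb (join_filter c FT) (sub c)).
by apply/(filter_coentails FT (join_comm FT b c)).
Qed.

End Generation.

(** * Finite algebras *)

(** Some coordinate separates the coatom [c] from [1]. If it identified [x] and [y] with [imp A x y]
    different from [1], it would send [imp A x y], which is below [c], to [1], and so also [c].
    Hence that coordinate is injective, and it is an isomorphism. *)
Lemma coatom_subdirectly_irreducible p I (A : crl p I) c :
  (forall x, le A x (Defs.one A)) -> c <> Defs.one A ->
  (forall x, x <> Defs.one A -> le A x c) -> subdirectly_irreducible A.
Proof.
move=> le1 c1 cmax J U B f fhom finj fsurj.
have imp1 x y : imp A x y = Defs.one A -> le A x y.
  move=> xy; have := (residuation A x (Defs.one A) y).2.
  by rewrite (mulC A x) (mul1 A) xy; apply; exact: le1.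
have le_refl x : le A x x by rewrite /le -{2}(meetK A x x) joinK.
have impxx x : imp A x x = Defs.one A.
  have := (residuation A x (Defs.one A) x).1.
  rewrite (mulC A x) (mul1 A) => /(_ (le_refl x)) <-.
  by rewrite meetC; exact/esym/le1.
have [i fic] : exists i, f c i <> f (Defs.one A) i.
  apply: contrapT => H; apply: c1; apply: finj.
  apply: functional_extensionality_dep => i.
  by apply: contrapT => H'; apply: H; exists i.
exists i, (fun x => f x i).
  case: fhom => fM fI fm fj f1 f0.
  split=> [x y|x y|x y|x y||h]; by rewrite ?fM ?fI ?fm ?fj ?f1 ?f0.
have sub x y : f x i = f y i -> le A x y.
  move=> fxy; apply: imp1; apply: contrapT => /cmax H; apply: fic.
  have fxy1 : f (imp A x y) i = f (Defs.one A) i.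
    by rewrite (hom_imp fhom) /= fxy -(impxx y) (hom_imp fhom).
  have := congr1 (f ^~ i) H; rewrite /= (hom_meet fhom) /= fxy1 => <-.
  have := congr1 (f ^~ i) (le1 c); rewrite /= (hom_meet fhom) /= => {1}<-.
  by rewrite meetC.
have inj : injective (fun x => f x i).
  by move=> x y xy; rewrite -(sub x y xy) meetC; exact: sub (esym xy).
have [g gP] := choice (fsurj i).
by exists g => // x; apply: inj; rewrite gP.
Qed.

Section FragmentAlgebra.
Variables (k : nat) (p : bool) (T : set (formula p)).
Hypothesis FT : dfilter k T.
Variables (n : nat) (r : 'I_n -> formula p).
Local Notation "a <~ b" := (entails T a b) (at level 70).
Local Notation "a =~ b" := (coentails T a b) (at level 70).
Hypothesis r_inj : forall i j, r i =~ r j -> i = j.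
Hypothesis r_one : exists i, r i =~ One.
Hypothesis r_bot : exists i, r i =~ Bot.
Hypothesis r_zero : forall h : p, exists i, r i =~ Zero h.
Hypothesis r_mul : forall i j, exists l, r l =~ Mul (r i) (r j).
Hypothesis r_join : forall i j, exists l, r l =~ Join (r i) (r j).

Let refl := entails_refl FT.
Let trans := @entails_trans _ _ _ FT.
Let eqT b a c : a =~ b -> b =~ c -> a =~ c.
Proof. exact: (coentails_trans FT). Qed.
Let eqR := coentails_refl FT.

(** A finite join of members of the fragment. The factor [x] is carried along to serve both uses:
    [One] for meets, [r i] for residuals. *)
Lemma fragment_lub (P : pred 'I_n) : exists m,
  (forall i, P i -> r i <~ r m) /\
  (forall x y, (forall i, P i -> Mul x (r i) <~ y) -> Mul x (r m) <~ y).
Proof.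
suff [m [ub lub]] : exists m, (forall i, i \in enum P -> r i <~ r m) /\
    (forall x y, (forall i, i \in enum P -> Mul x (r i) <~ y) ->
       Mul x (r m) <~ y).
  exists m; split=> [i Pi|x y H]; first by apply: ub; rewrite mem_enum.
  by apply: lub => i; rewrite mem_enum; exact: H.
elim: (enum P) => [|i s [m [ub lub]]].
  have [m [mB _]] := r_bot; exists m; split=> // x y _.
  apply: trans (mul_entails2 FT _ _) _.
  exact: trans mB (bot_entails FT y).
have [l [lm ml]] := r_join i m; exists l; split=> [j|x y H].
  rewrite in_cons => /orP[/eqP->|/ub jm]; apply: trans ml.
    exact: (entails_join1 FT).
  exact: trans jm (entails_join2 FT _ _).
apply: trans (mul_comm FT _ _).1 _; apply/(entails_mul FT).
apply: trans lm _; apply: (join_entails FT); apply/(entails_mul FT);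
  apply: trans (mul_comm FT _ _).1 _.
  by apply: H; exact: mem_head.
by apply: lub => j js; apply: H; rewrite in_cons js orbT.
Qed.

(** The witness is the join of all common lower bounds inside the fragment. It may lie strictly
    below [Meet (r i) (r j)], which is why the pairs where both agree are recorded later. *)
Lemma fragment_meet i j : exists m,
  [/\ r m <~ r i, r m <~ r j &
      forall l, r l <~ r i -> r l <~ r j -> r l <~ r m].
Proof.
have [m [ub lub]] := fragment_lub (fun l => `[< r l <~ r i /\ r l <~ r j >]).
have le_m z : (forall l, r l <~ r i /\ r l <~ r j -> r l <~ z) -> r m <~ z.
  move=> H; apply: trans (mul_one FT _).2 _; apply: lub => l /asboolP/H.
  exact: trans (mul_one FT _).1.
exists m; split=> [||l li lj].
- by apply: le_m => l [].
- by apply: le_m => l [].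
- by apply: ub; exact/asboolP.
Qed.

(** The witness is the join of all solutions [l] in the fragment, itself a solution because
    multiplication preserves joins. *)
Lemma fragment_imp i j : exists m,
  forall l, Mul (r i) (r l) <~ r j <-> r l <~ r m.
Proof.
have [m [ub lub]] := fragment_lub (fun l => `[< Mul (r i) (r l) <~ r j >]).
exists m => l; split=> H; first by apply: ub; exact/asboolP.
apply: trans (mul_entails FT (refl _) H) _.
by apply: lub => l' /asboolP.
Qed.

Lemma fragment_algebra : exists A : kcirl k p 'I_n,
  [/\ forall i j, le A i j <-> r i <~ r j,
      r (Defs.one A) =~ One /\ r (bot A) =~ Bot,
      forall h, r (Defs.zero A h) =~ Zero h,
      forall i j, r (Defs.mul A i j) =~ Mul (r i) (r j) &
      forall i j, r (join A i j) =~ Join (r i) (r j)].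
Proof.
(* The operations are picked by choice; their laws hold modulo [T] and descend to indices through
   [r_inj]. *)
pose one := projT1 (cid r_one); pose bot := projT1 (cid r_bot).
pose zero h := projT1 (cid (r_zero h)).
pose mul i j := projT1 (cid (r_mul i j)).
pose join i j := projT1 (cid (r_join i j)).
pose meet i j := projT1 (cid (fragment_meet i j)).
pose imp i j := projT1 (cid (fragment_imp i j)).
have oneE : r one =~ One by exact: projT2 (cid r_one).
have botE : r bot =~ Bot by exact: projT2 (cid r_bot).
have zeroE h : r (zero h) =~ Zero h by exact: projT2 (cid (r_zero h)).
have mulE i j : r (mul i j) =~ Mul (r i) (r j).
  exact: projT2 (cid (r_mul i j)).
have joinE i j : r (join i j) =~ Join (r i) (r j).
  exact: projT2 (cid (r_join i j)).
have meetP i j : [/\ r (meet i j) <~ r i, r (meet i j) <~ r j &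
    forall l, r l <~ r i -> r l <~ r j -> r l <~ r (meet i j)].
  exact: projT2 (cid (fragment_meet i j)).
have impP i j l : Mul (r i) (r l) <~ r j <-> r l <~ r (imp i j).
  exact: projT2 (cid (fragment_imp i j)) l.
have meet1 i j : r (meet i j) <~ r i by case: (meetP i j).
have meet2 i j : r (meet i j) <~ r j by case: (meetP i j).
have glb i j l : r l <~ r i -> r l <~ r j -> r l <~ r (meet i j).
  by case: (meetP i j) => _ _; apply.
have join1 i j : r i <~ r (join i j).
  exact: trans (entails_join1 FT _ _) (joinE i j).2.
have join2 i j : r j <~ r (join i j).
  exact: trans (entails_join2 FT _ _) (joinE i j).2.
have lub i j l : r i <~ r l -> r j <~ r l -> r (join i j) <~ r l.
  by move=> il jl; apply: trans (joinE i j).1 _; exact: (join_entails FT).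
have anti i j : r i <~ r j -> r j <~ r i -> i = j.
  by move=> ij ji; apply: r_inj; split.
have leE i j : meet i j = i <-> r i <~ r j.
  by split=> [<-//|ij]; apply: anti => //; exact: glb.
have eqM a a' b b' : a =~ a' -> b =~ b' -> Mul a b =~ Mul a' b'.
  by move=> [? ?] [? ?]; split; exact: (mul_entails FT).
have mulA : associative mul.
  move=> x y z; apply: r_inj.
  have left : r (mul x (mul y z)) =~ Mul (r x) (Mul (r y) (r z)).
    exact: eqT (mulE x _) (eqM _ _ _ _ (eqR (r x)) (mulE y z)).
  have right : r (mul (mul x y) z) =~ Mul (Mul (r x) (r y)) (r z).
    exact: eqT (mulE _ z) (eqM _ _ _ _ (mulE x y) (eqR (r z))).
  apply: eqT left _; apply: eqT (coentails_sym right).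
  exact: (mul_assoc FT).
have mulC : commutative mul.
  move=> x y; apply: r_inj; apply: eqT (mulE x y) _.
  exact: (eqT (mul_comm FT _ _) (coentails_sym (mulE y x))).
have mul1 : left_id one mul.
  move=> x; apply: r_inj; apply: eqT (mulE one x) _.
  exact: (eqT (eqM _ _ _ _ oneE (eqR (r x))) (mul_one FT (r x))).
have meetA : associative meet.
  move=> x y z; apply: anti.
    apply: (glb); last exact: trans (meet2 _ _) (meet2 _ _).
    by apply: (glb) => //; exact: trans (meet2 _ _) (meet1 _ _).
  apply: (glb); first exact: trans (meet1 _ _) (meet1 _ _).
  by apply: (glb) => //; exact: trans (meet1 _ _) (meet2 _ _).
have meetC : commutative meet.
  by move=> x y; apply: anti; apply: (glb).
have joinA : associative join.
  move=> x y z; apply: anti.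
    apply: (lub); first exact: trans (join1 _ _) (join1 _ _).
    by apply: (lub) => //; exact: trans (join2 _ _) (join1 _ _).
  apply: (lub); last exact: trans (join2 _ _) (join2 _ _).
  by apply: (lub) => //; exact: trans (join1 _ _) (join2 _ _).
have joinC : commutative join.
  by move=> x y; apply: anti; apply: (lub).
have joinK x y : meet x (join x y) = x by apply/leE.
have meetK x y : join x (meet x y) = x.
  by apply: anti => //; apply: lub => //; exact: refl.
have res x y z : meet (mul x y) z = mul x y <-> meet y (imp x z) = y.
  rewrite !leE -impP; split; apply: trans; [exact: (mulE _ _).2|].
  exact: (mulE _ _).1.
pose A := CRL zero mulA mulC mul1 meetA meetC joinA joinC joinK meetK res.
have powE x m : r (pow A x m) =~ Pow (r x) m.
  elim: m => [|m IH] //; rewrite /pow /Pow !iterS.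
  by apply: eqT (mulE _ _) _; apply: eqM.
have A_bot x : le A bot x.
  by apply/leE; apply: trans botE.1 _; exact: (bot_entails FT).
have A_one x : le A x one.
  by apply/leE; apply: trans oneE.2; exact: (entails_one FT).
have A_pot x : pow A x k = pow A x k.+1.
  apply: r_inj; apply: eqT (powE _ _) _.
  apply: eqT (coentails_sym (powE _ _)).
  by split; [exact: (pow_potent FT)|exact: (pow_entails FT)].
by exists (@KCIRL k p _ A bot A_bot A_one A_pot).
Qed.

(** By primeness a finite join of formulas outside [T] stays outside [T]; the witness is the join of
    all such members of the fragment. *)
Lemma fragment_coatom : prime_filter T -> (exists a, ~ T a) ->
  exists c, ~ T (r c) /\ forall i, ~ T (r i) -> r i <~ r c.
Proof.
move=> prT [a Ta].
suff [c [Tc cmax]] : exists c, ~ T (r c) /\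
    forall i, i \in enum (fun i => `[< ~ T (r i) >]) -> r i <~ r c.
  exists c; split=> // i Ti; apply: cmax; rewrite mem_enum.
  exact/asboolP.
have : forall i, i \in enum (fun i => `[< ~ T (r i) >]) -> ~ T (r i).
  by move=> i; rewrite mem_enum => /asboolP.
elim: (enum _) => [_|i s IH Ts].
  (* The empty join [Bot] is outside [T] because [T] is proper. *)
  have [m [mB _]] := r_bot; exists m; split=> // Tm; apply: Ta.
  by apply: FT.2 (FT.2 _ _ mB Tm); exact: (bot_entails FT).
have [j js|c [Tc cmax]] := IH; first by apply: Ts; rewrite in_cons js orbT.
have [l [lE1 lE2]] := r_join i c; exists l; split.
  move=> Tl; case: (prT _ _ (FT.2 _ _ lE1 Tl)) => //.
  by apply: Ts; exact: mem_head.
move=> j; rewrite in_cons => /orP[/eqP->|/cmax jc]; apply: trans lE2.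
  exact: (entails_join1 FT).
exact: trans jc (entails_join2 FT _ _).
Qed.

End FragmentAlgebra.

(** * Canonical formulas *)

Fixpoint subformulas p (a : formula p) : seq (formula p) :=
  a :: match a with
  | Mul b c | Imp b c | Meet b c | Join b c => subformulas b ++ subformulas c
  | _ => [::]
  end.

Lemma subformulas_id p (a : formula p) : a \in subformulas a.
Proof. by case: a => *; exact: mem_head. Qed.

Lemma zero_clauseP k p (I : finType) (A : kcirl k p I) a :
  a \in zero_clause A <->
  exists h : p, a = Iff (X p (Defs.zero A h)) (Zero h).
Proof.
case: p A a => A a; last by split=> [|[]//]; rewrite in_nil.
split=> [|[h ->]]; first by rewrite mem_seq1 => /eqP->; exists isT.
by rewrite (bool_irrelevance h isT) mem_seq1.
Qed.

Lemma clausesP p (I : finType) (op : I -> I -> I) con (D : {set I * I})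
    (a : formula p) :
  a \in clauses op con D <-> exists i j,
    (i, j) \in D /\ a = Iff (X p (op i j)) (con (X p i) (X p j)).
Proof.
split=> [/fintype.imageP[[i j] ijD ->]|[i [j [ijD ->]]]]; first by exists i, j.
by apply/fintype.imageP; exists (i, j).
Qed.

Section GammaConjuncts.
Variables (k : nat) (p : bool) (I : finType) (A : kcirl k p I).
Variables Dmeet Dimp : {set I * I}.

(** [conjunct i a] encodes the conjunct [Iff (X p i) a] of [Gamma], so that list membership becomes
    case analysis. *)
Inductive conjunct : I -> formula p -> Prop :=
| conjunct_bot : conjunct (bot A) Bot
| conjunct_one : conjunct (Defs.one A) One
| conjunct_zero h : conjunct (Defs.zero A h) (Zero h)
| conjunct_mul i j : conjunct (Defs.mul A i j) (Mul (X p i) (X p j))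
| conjunct_join i j : conjunct (join A i j) (Join (X p i) (X p j))
| conjunct_imp i j : (i, j) \in Dimp ->
    conjunct (imp A i j) (Imp (X p i) (X p j))
| conjunct_meet i j : (i, j) \in Dmeet ->
    conjunct (meet A i j) (Meet (X p i) (X p j)).

Lemma filter_Gamma (T : set (formula p)) s : dfilter k T ->
  T (subst s (Gamma A Dmeet Dimp)) <->
  forall i a, conjunct i a -> coentails T (subst s (X p i)) (subst s a).
Proof.
move=> FT; rewrite /Gamma subst_BigMeet (filter_BigMeet FT).
split=> [H i a ia|H _ /mapP[a + ->]].
  apply/(filter_Iff FT); apply: (H (subst s (Iff (X p i) a))).
  apply: map_f; rewrite !mem_cat !in_cons.
  case: ia => [||h|i' j|i' j|i' j ij|i' j ij]; rewrite ?eqxx ?orbT //.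
  - have -> // : Iff (X p (Defs.zero A h)) (Zero h) \in zero_clause A.
      by apply/zero_clauseP; exists h.
    by rewrite orbT.
  - have -> : Iff (X p (Defs.mul A i' j)) (Mul (X p i') (X p j)) \in
        clauses (Defs.mul A) (@Mul p) [set: I * I]%SET.
      by apply/clausesP; exists i', j; rewrite finset.in_setT.
    by rewrite !orbT.
  - have -> : Iff (X p (join A i' j)) (Join (X p i') (X p j)) \in
        clauses (join A) (@Join p) [set: I * I]%SET.
      by apply/clausesP; exists i', j; rewrite finset.in_setT.
    by rewrite !orbT.
  - have -> : Iff (X p (imp A i' j)) (Imp (X p i') (X p j)) \in
        clauses (imp A) (@Imp p) Dimp by apply/clausesP; exists i', j.
    by rewrite !orbT.
  - have -> : Iff (X p (meet A i' j)) (Meet (X p i') (X p j)) \in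
        clauses (meet A) (@Meet p) Dmeet by apply/clausesP; exists i', j.
    by rewrite !orbT.
have {}H i b : conjunct i b -> T (subst s (Iff (X p i) b)).
  by move=> ib; apply/(filter_Iff FT); exact: H.
rewrite !mem_cat !in_cons in_nil orbF.
case/or4P => [/orP[]/eqP->|/zero_clauseP[h ->]|/clausesP[i [j [_ ->]]]|];
  try by apply: H; constructor.
by case/or3P => /clausesP[i [j [ijD ->]]]; apply: H; constructor.
Qed.

End GammaConjuncts.

Section CRLOrder.
Variables (p : bool) (I : Type) (A : crl p I).

Lemma crl_le_refl x : le A x x.
Proof. by rewrite /le -{2}(meetK A x x) joinK. Qed.

Lemma crl_meet1 x y : le A (meet A x y) x.
Proof. by rewrite /le meetC meetA crl_le_refl. Qed.

Lemma crl_meet2 x y : le A (meet A x y) y.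
Proof. by rewrite /le -meetA crl_le_refl. Qed.

Lemma crl_glb x y z : le A z x -> le A z y -> le A z (meet A x y).
Proof. by rewrite /le meetA => -> ->. Qed.

End CRLOrder.

(** * The canonical formula of a fragment: refutation and derivability *)

Section Representation.
Variables (k : nat) (p : bool) (T : set (formula p)).
Hypothesis FT : dfilter k T.
Variables (n : nat) (r : 'I_n -> formula p) (A : kcirl k p 'I_n).
Local Notation "a =~ b" := (coentails T a b) (at level 70).
Hypothesis r_inj : forall i j, r i =~ r j -> i = j.
Hypothesis r_le : forall i j, le A i j <-> entails T (r i) (r j).
Hypothesis r_one : r (Defs.one A) =~ One.
Hypothesis r_bot : r (bot A) =~ Bot.
Hypothesis r_zero : forall h, r (Defs.zero A h) =~ Zero h.
Hypothesis r_mul : forall i j, r (Defs.mul A i j) =~ Mul (r i) (r j).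
Hypothesis r_join : forall i j, r (join A i j) =~ Join (r i) (r j).

Let trans b a c : entails T a b -> entails T b c -> entails T a c.
Proof. exact: (entails_trans FT). Qed.

Let eqT b a c : a =~ b -> b =~ c -> a =~ c.
Proof. exact: (coentails_trans FT). Qed.

(* The largest admissible choices of [Dmeet] and [Dimp]. *)
Definition preserved (op : 'I_n -> 'I_n -> 'I_n)
    (con : formula p -> formula p -> formula p) : {set 'I_n * 'I_n} :=
  finset (fun ij =>
    `[< coentails T (r (op ij.1 ij.2)) (con (r ij.1) (r ij.2)) >]).

Let G := Gamma A (preserved (meet A) (@Meet p)) (preserved (imp A) (@Imp p)).

Definition canonical_of : formula p :=
  gamma A (preserved (meet A) (@Meet p)) (preserved (imp A) (@Imp p)).

Lemma preservedP op con i j :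
  (i, j) \in preserved op con <-> r (op i j) =~ con (r i) (r j).
Proof. by rewrite finset.in_set; split=> /asboolP. Qed.

(** An implication modulo [T] that is represented in the fragment satisfies the adjunction defining
    [imp A], so the two residuals agree. *)
Lemma preserved_imp i j l : r l =~ Imp (r i) (r j) ->
  imp A i j = l /\ (i, j) \in preserved (imp A) (@Imp p).
Proof.
move=> lij; suff ijl : imp A i j = l.
  by split=> //; apply/preservedP; rewrite ijl.
have adj m : le A m (imp A i j) <-> entails T (r m) (r l).
  rewrite /le -residuation -[meet _ _ _ = _]/(le A _ _) r_le.
  split=> H.
    apply: trans lij.2; apply/(entails_mul FT).
    apply: trans (mul_comm FT _ _).1 _; exact: trans (r_mul i m).2 H.
  apply: trans (r_mul i m).1 _; apply: trans (mul_comm FT _ _).1 _.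
  by apply/(entails_mul FT); exact: trans H lij.1.
apply: r_inj; split; first by apply/adj; exact: crl_le_refl.
by apply/r_le/adj; exact: entails_refl FT _.
Qed.

Lemma preserved_meet i j l : r l =~ Meet (r i) (r j) ->
  meet A i j = l /\ (i, j) \in preserved (meet A) (@Meet p).
Proof.
move=> lij; suff ijl : meet A i j = l.
  by split=> //; apply/preservedP; rewrite ijl.
apply: r_inj; split.
  apply: trans lij.2.
  by apply: (entails_meet FT); apply/r_le; [exact: crl_meet1|exact: crl_meet2].
apply/r_le; apply: crl_glb; apply/r_le; apply: trans lij.1 _.
  exact: (meet_entails1 FT).
exact: (meet_entails2 FT).
Qed.

(** The substitution of [r i] for [X p i]: [codom r] lists the values of [r] in the order of
    [enum_rank]. Numbers beyond the algebra get the default [Bot]. *)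
Definition unname (m : nat) : formula p := nth Bot (codom r) m.

Lemma unname_rank i : unname (enum_rank i) = r i.
Proof. by rewrite /unname nth_codom enum_rankK. Qed.

Lemma subst_Gamma : T (subst unname G).
Proof.
apply/(filter_Gamma _ _ _ _ FT) => i a ia; rewrite /= unname_rank.
case: ia => [||h|i' j|i' j|i' j ij|i' j ij] //.
- by rewrite /= !unname_rank.
- by rewrite /= !unname_rank.
- rewrite /= !unname_rank.
  exact/preservedP.
- rewrite /= !unname_rank.
  exact/preservedP.
Qed.

Lemma prime_filter_BigJoin (s : seq (formula p)) :
  prime_filter T -> (exists a, ~ T a) -> T (BigJoin s) ->
  exists2 a, a \in s & T a.
Proof.
move=> prT [c Tc]; rewrite /BigJoin; elim: s => [|a s IH].
  by rewrite big_nil => TB; case: Tc; apply: FT.2 TB; exact: bot_entails FT _.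
rewrite big_cons => /prT[Ta|/IH[b bs Tb]]; first by exists a; rewrite ?mem_head.
by exists b => //; rewrite in_cons bs orbT.
Qed.

(** Under [unname] the premise [Gamma], and so its power, lies in [T]. Primeness would then put a
    single disjunct [Imp (r i) (r j)] with [i] not below [j] in [T], against [r_le]. *)
Lemma canonical_of_refuted : prime_filter T -> (exists a, ~ T a) ->
  ~ T (subst unname canonical_of).
Proof.
move=> prT exT; rewrite /canonical_of /gamma -/G /= subst_Pow => TG.
have : T (Pow (subst unname G) k).
  apply/(one_entails FT); have := (one_entails FT _).2 subst_Gamma.
  elim: k => [|m IH] H; first exact: entails_refl FT _.
  apply: trans (mul_entails FT H (IH H)); exact: (mul_one FT One).2.
move/(FT.2 _ _ TG); rewrite /Delta subst_BigJoin.
move/(prime_filter_BigJoin prT exT).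
move=> [_ /mapP[_ /fintype.imageP[[i j] + ->] ->]].
by move=> /eqP ij; rewrite /= !unname_rank => /r_le.
Qed.

Variables (Sigma : set (formula p)) (c : formula p).
Hypothesis c_covered : forall a, a \in subformulas c -> exists i, r i =~ a.

(** By the deduction theorem it is enough to find a disjunct of [Delta] in the filter [U] generated
    by the logic and [Gamma]. There [Gamma] identifies an instance of [c] with the variable of the
    class of [c]; the instance is a theorem, and that class is not [1] because [c] is outside
    [T]. *)
Lemma canonical_of_derivable :
  logic k Sigma c -> ~ T c -> logic k Sigma canonical_of.
Proof.
move=> Lc Tc; set L := logic k Sigma.
have FL : dfilter k L by exact: logic_filter.
apply: (deduction FL); set U := ded _ _.
have FU : dfilter k U by exact: ded_filter.
have UG : U G by apply: ded_hyp; right.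
(* [v a] is the index of the class of [a], with default [bot A] for formulas outside the
   fragment. *)
have [v vP] : {v : formula p -> 'I_n &
    forall a, (exists i, r i =~ a) -> r (v a) =~ a}.
  apply: (@choice _ _ (fun a i => (exists i, r i =~ a) -> r i =~ a)) => a.
  by have [[i ia]|H] := pselect (exists i, r i =~ a);
    [exists i|exists (bot A)].
have uE i a : r i =~ a -> (exists j, r j =~ a) -> v a = i.
  move=> ia /vP va; apply: r_inj; exact: eqT va (coentails_sym ia).
(* The identity substitution [Var] turns [filter_Gamma] into a statement about [Gamma] itself. *)
have UX i a : conjunct A (preserved (meet A) (@Meet p))
    (preserved (imp A) (@Imp p)) i a -> coentails U (X p i) a.
  have := (filter_Gamma A (preserved (meet A) (@Meet p))
    (preserved (imp A) (@Imp p)) Var FU).1.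
  by rewrite subst_id => /(_ UG i a); rewrite !subst_id.
pose w m := X p (v (Var m)).
have const i a : r i =~ a -> (exists j, r j =~ a) -> coentails U (X p i) a ->
    coentails U a (X p (v a)).
  by move=> ia aP H; rewrite (uE i a ia aP); exact: coentails_sym H.
have binary (con : formula p -> formula p -> formula p) i a b :
    Proper (coentails U ==> coentails U ==> coentails U) con ->
    coentails U (subst w a) (X p (v a)) ->
    coentails U (subst w b) (X p (v b)) -> v (con a b) = i ->
    coentails U (X p i) (con (X p (v a)) (X p (v b))) ->
    coentails U (con (subst w a) (subst w b)) (X p (v (con a b))).
  move=> conP Ha Hb -> H; apply: (coentails_trans FU) (coentails_sym H).
  exact: conP.
pose covered (s : seq (formula p)) := forall a, a \in s -> exists i, r i =~ a.
have parts d a b : covered (d :: subformulas a ++ subformulas b) ->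
    [/\ covered (subformulas a), covered (subformulas b),
        r (v a) =~ a, r (v b) =~ b & r (v d) =~ d].
  move=> cov.
  have cova : covered (subformulas a).
    by move=> x xa; apply: cov; rewrite in_cons mem_cat xa orbT.
  have covb : covered (subformulas b).
    by move=> x xb; apply: cov; rewrite in_cons mem_cat xb !orbT.
  split=> //; apply: vP;
    [apply: cova|apply: covb|by apply: cov; exact: mem_head];
    exact: subformulas_id.
(* Products and joins are always described by [Gamma]. For implications and meets, the compound is
   itself a covered subformula, so its pair is preserved and [Gamma] has the conjunct. *)
have main a : covered (subformulas a) ->
    coentails U (subst w a) (X p (v a)).
  elim: a => [m|||h|a IHa b IHb|a IHa b IHb|a IHa b IHb|a IHa b IHb] /= cov;
    have cov0 := cov _ (mem_head _ _).
  - exact: coentails_refl FU _.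
  - by apply: (const _ _ r_one cov0); apply: UX; constructor.
  - by apply: (const _ _ r_bot cov0); apply: UX; constructor.
  - by apply: (const _ _ (r_zero h) cov0); apply: UX; constructor.
  - have [cova covb va vb vab] := parts _ _ _ cov.
    apply: (binary _ (Defs.mul A (v a) (v b)) _ _ _ (IHa cova) (IHb covb)).
    + exact: (Mul_Proper FU).
    + by apply: uE cov0; apply: eqT (r_mul _ _) _; exact: (Mul_Proper FT).
    + by apply: UX; constructor.
  - have [cova covb va vb vab] := parts _ _ _ cov.
    have [vE vD] := preserved_imp
      (eqT vab (coentails_sym (Imp_Proper FT va vb))).
    apply: (binary _ _ _ _ _ (IHa cova) (IHb covb) (esym vE)).
      exact: (Imp_Proper FU).
    by apply: UX; constructor.
  - have [cova covb va vb vab] := parts _ _ _ cov.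
    have [vE vD] := preserved_meet
      (eqT vab (coentails_sym (Meet_Proper FT va vb))).
    apply: (binary _ _ _ _ _ (IHa cova) (IHb covb) (esym vE)).
      exact: (Meet_Proper FU).
    by apply: UX; constructor.
  - have [cova covb va vb vab] := parts _ _ _ cov.
    apply: (binary _ (join A (v a) (v b)) _ _ _ (IHa cova) (IHb covb)).
    + exact: (Join_Proper FU).
    + by apply: uE cov0; apply: eqT (r_join _ _) _; exact: (Join_Proper FT).
    + by apply: UX; constructor.
have Uc : U (X p (v c)).
  apply/(filter_coentails FU (main c c_covered)).
  apply: ded_hyp; left; exact: (derives_subst w Lc).
(* This is the disjunct of [Delta] for the pair of [1] and the class of [c]. *)
have U1 : U (Imp (X p (Defs.one A)) (X p (v c))).
  by apply: (filter1 FU) Uc; apply: d_impR; apply: d_weakening; exact: d_id.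
apply: (filter_BigJoin FU _ U1); apply/fintype.imageP.
exists (Defs.one A, v c) => //; rewrite inE /=; apply/eqP => /r_le one_c.
apply: Tc; apply/(one_entails FT).
apply: trans r_one.2 _; apply: trans one_c _.
by case: (vP _ (c_covered (subformulas_id c))).
Qed.

End Representation.

(** * Separation by canonical formulas and axiomatisation *)

Lemma canonical_separation k p (S : set (formula p)) c : ~ logic k S c ->
  exists g, [/\ canonical_formulas k p g, ~ logic k S g &
    forall S', logic k S' c -> logic k S' g].
Proof.
move=> Sc; have [|T [FT sST Tc prT]] := @prime_extension k p (logic k S) c.
  by move=> H; apply: Sc; exact: ded_min (logic_filter k S) (fun _ H => H) _ H.
have exT : exists a, ~ T a by exists c.
(* [Zero], when present, joins the generators so that the fragment can interpret it. *)
have [zs zsP] : exists zs : seq (formula p), forall h : p, Zero h \in zs.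
  clear; case: p => [|]; last by exists [::].
  by exists [:: Zero isT] => h; rewrite (bool_irrelevance h isT) mem_head.
have [n [r [r_inj cov [r_one r_bot] r_mul r_join]]] :=
  finite_fragment FT (subformulas c ++ zs).
have r_zero (h : p) : exists i, coentails T (r i) (Zero h).
  by apply: cov; rewrite mem_cat zsP orbT.
have [A [leA [A_one A_bot] A_zero A_mul A_join]] :=
  fragment_algebra FT r_inj r_one r_bot r_zero r_mul r_join.
(* The members of the fragment in [T] form the single class [1], so the largest member outside [T]
   is the coatom. *)
have oneP i : T (r i) <-> i = Defs.one A.
  split=> [Ti|->]; last exact: FT.2 A_one.2 (FT.1 _ (d_oneR _ _)).
  apply: r_inj; apply: (coentails_trans FT) (coentails_sym A_one).
  by split; [exact: (entails_one FT)|exact/(one_entails FT)].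
have [d [Td dmax]] := fragment_coatom FT r_bot r_join prT exT.
exists (canonical_of T r A); split.
- exists 'I_n, A, (preserved T r (meet A) (@Meet p)),
    (preserved T r (imp A) (@Imp p)); split=> //.
  apply (@coatom_subdirectly_irreducible _ _ _ d).
  + exact: le_one.
  + by move/oneP.
  + by move=> i i1; apply/leA/dmax => /oneP.
(* A theorem of [S] would have all its instances in [T], but [T] omits the instance given by
   [unname]. *)
- move=> Sg.
  apply: (canonical_of_refuted FT leA A_one A_bot A_zero A_mul A_join prT exT).
  by apply: sST; exact: (derives_subst _ Sg).
- move=> S' S'c.
  apply: (canonical_of_derivable FT r_inj leA A_one A_bot A_zero A_mul A_join)
    S'c Tc => a ac.
  by apply: cov; rewrite mem_cat ac.
Qed.

Theorem theorem3p11 (k : nat) (p : bool) (L : set (formula p)) :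
  is_extension k L ->
  (exists Sigma : set (formula p),
     Sigma `<=` canonical_formulas k p /\ axiomatised_by k L Sigma) /\
  (finitely_axiomatisable k L ->
   exists Sigma : set (formula p),
     [/\ finite_set Sigma, Sigma `<=` canonical_formulas k p
       & axiomatised_by k L Sigma]).
Proof.
move=> [S0 LS0].
have closed S : S `<=` L -> logic k S `<=` L.
  by rewrite LS0 => SL a; exact: derives_trans.
(* A theorem of [L] not derivable from the canonical theorems would yield, by separation, a
   canonical theorem of [L] not derivable from them either. *)
have LE : axiomatised_by k L (L `&` canonical_formulas k p).
  rewrite /axiomatised_by eqEsubset; split; last by apply: closed => a [].
  move=> c Lc; apply: contrapT => /canonical_separation[g [cg Sg Lg]].
  apply: Sg; apply: derives_axiom; split=> //.
  by rewrite LS0 in Lc *; exact: Lg.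
split; first by exists (L `&` canonical_formulas k p).
move=> [F finF LF].
(* By compactness each axiom in the finite set [F] needs finitely many canonical theorems; the union
   over [F] is still finite and axiomatises [L]. *)
have [f fP] : {f : formula p -> set (formula p) & forall a, F a ->
    [/\ finite_set (f a), f a `<=` L `&` canonical_formulas k p &
        derives k (f a) [::] a]}.
  apply: (@choice _ _ (fun a Sa => F a -> [/\ finite_set Sa,
    Sa `<=` L `&` canonical_formulas k p & derives k Sa [::] a])) => a.
  have [Fa|] := pselect (F a); last by exists set0.
  have : logic k (L `&` canonical_formulas k p) a.
    by rewrite -LE LF; exact: derives_axiom.
  by move=> /derives_compact[Sa H]; exists Sa.
have sub : \bigcup_(a in F) f a `<=` L `&` canonical_formulas k p.
  by apply: bigcup_sub => a /fP[].
exists (\bigcup_(a in F) f a); split.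
- by apply: bigcup_finite => // a /fP[].
- by move=> a /sub[].
rewrite /axiomatised_by eqEsubset; split; last by apply: closed => a /sub[].
rewrite {1}LF => a; apply: derives_trans => b Fb.
have [_ _] := fP b Fb; apply: derives_mono => g fg; by exists b.
Qed.
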